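(* Let $X$ be a compact metric space. If $X$ admits a positively expansive continuous map $f:X\to X$, then $X$ has finite topological dimension. If moreover $f$ can be chosen with zero topological entropy (i.e. if $X$ admits a positively expansive continuous map $f:X\to X$ with $h(f)=0$), then $X$ is totally disconnected.
   Context: A continuous map $f:X\to X$ of a compact metric space $(X,d)$ is called positively expansive if there is $c>0$ such that if $d(f^n(x),f^n(y))\leq c$ for all $n\geq0$, then $x=y$. The topological dimension of $X$ is the Lebesgue covering dimension: the smallest integer $m$ such that for each $\epsilon>0$ there is a cover of $X$ by open sets of diameter $\leq\epsilon$ such that each point of $X$ belongs to at most $m+1$ members of the cover; if no such $m$ exists the topological dimension is $\infty$. $h(f)$ denotes the topological entropy of $f$. *)

(* Defs.v *)
From HB Require Import structures.
From mathcomp Require Import all_boot all_order all_algebra finmap.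
From mathcomp Require Import all_classical all_reals all_analysis.

Set Implicit Arguments.
Unset Strict Implicit.
Unset Printing Implicit Defensive.

Import Order.TTheory GRing.Theory Num.Theory.
Import numFieldNormedType.Exports.

Local Open Scope classical_set_scope.
Local Open Scope ring_scope.

Section definitions.
Context {R : realType} {X : metricType R}.
Implicit Types (f : X -> X) (V : set X) (A : {fset X}).

Definition positively_expansive f : Prop :=
  exists2 c : R, 0 < c &
    forall x y, (forall n, mdist (iter n f x) (iter n f y) <= c) -> x = y.

(* The empty set has diameter -oo; diameters are only compared with positive
   bounds below. *)
Definition diameter V : \bar R :=
  ereal_sup [set (mdist p.1 p.2)%:E | p in V `*` V].

Definition covering_dimension_le (m : nat) : Prop :=
  forall e : R, 0 < e -> exists U : set (set X),
    [/\ cover U id = [set: X],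
        forall V, U V -> open V,
        forall V, U V -> (diameter V <= e%:E)%E
      & forall x, ([set V | U V /\ V x] #<= `I_m.+1)%card].

(* Bowen's definition of entropy: n counts the points of the orbit segment
   x, f x, ..., f^(n-1) x. *)
Definition separated f (n : nat) (e : R) A : Prop :=
  forall x y, x \in A -> y \in A -> x != y ->
    exists2 i, (i < n)%N & e < mdist (iter i f x) (iter i f y).

(* As an extended real, so that no finiteness has to be assumed; it is a
   maximum when X is compact and f is continuous. *)
Definition max_separated f (n : nat) (e : R) : \bar R :=
  ereal_sup [set (#|` A|%:R)%:E | A in separated f n e].

Definition separated_growth f (e : R) : \bar R :=
  limn_esup (fun n => (n%:R^-1)%:E * lne (max_separated f n e))%E.

Lemma separated_growth_cvg f :
  separated_growth f e @[e --> 0^'+] -->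
  ereal_sup [set separated_growth f e | e in [set e : R | 0 < e]].
Proof.
have -> : [set e : R | 0 < e] = [set` Interval (BRight (0 : R)) +oo%O].
  by apply/seteqP; split => x /=; rewrite in_itv/= andbT.
apply: nonincreasing_at_right_cvge => //= e1 e2 _ _ e12.
rewrite /separated_growth !limn_esup_lim; apply: lee_lim.
- exact: is_cvg_esups.
- exact: is_cvg_esups.
- apply: nearW => n; apply: ge_ereal_sup => _ /= [m nm <-].
  apply: (@le_trans _ _ ((m%:R^-1)%:E * lne (max_separated f m e1))%E).
    have max0 e : (0 <= max_separated f m e)%E.
      apply: ereal_sup_ubound => /=; exists fset0; last by rewrite cardfs0.
      by move=> x y; rewrite inE.
    apply: lee_wpmul2l; first by rewrite lee_fin invr_ge0.
    rewrite lee_lne ?in_itv/= ?leey ?andbT//.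
    apply: ge_ereal_sup => _ /= [A sA <-]; apply: ereal_sup_ubound => /=.
    exists A => // x y xA yA xy; have [i im ei] := sA x y xA yA xy.
    by exists i => //; apply: le_lt_trans ei.
  by apply: ereal_sup_ubound => /=; exists m.
Qed.

Definition topological_entropy f : \bar R :=
  lim (separated_growth f e @[e --> 0^'+]).

End definitions.

(* The infimum is the least such m, and +oo when there is none; the empty
   space gets 0. *)
Definition topological_dimension (R : realType) (X : metricType R) : \bar R :=
  ereal_inf [set (m%:R)%:E | m in @covering_dimension_le R X].

(* Main.v *)
(* Orbits of two points that stay c-close for N steps start c/4-close, for some
   uniform N. Hence, for a maximal (N + n, c/4)-separated set, two centers whose
   Bowen balls of order N + n and radius c/2 meet are c/4-close for their first
   n steps, so f^n maps all the centers near a given point injectively onto an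
   (N, c/4)-separated set, whose size is bounded independently of n: the Bowen
   balls, whose diameters tend to 0, have bounded multiplicity.

   If a connected set contains two points, it contains chains with arbitrarily
   small steps joining them. A chain with endpoints c/4 apart is moved by some
   f^i, i < N, to a chain with endpoints more than c apart, whose initial and
   final pieces of diameter about c/4 are far from each other; iterating on both
   pieces yields 2^k points that are (k N, c/8)-separated, hence positive
   entropy. *)
Require Import Defs.
From mathcomp Require Import all_boot all_order all_algebra finmap.
From mathcomp Require Import all_classical all_reals all_analysis.
From mathcomp Require Import lra zify.

Set Implicit Arguments.
Unset Strict Implicit.
Unset Printing Implicit Defensive.

Import Order.TTheory GRing.Theory Num.Theory.
Import numFieldNormedType.Exports.

Local Open Scope classical_set_scope.
Local Open Scope ring_scope.

(* mathcomp-analysis has another [separated], about disjoint closures. *)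
Local Notation separated := Defs.separated.

(** * Bowen balls, separated sets and uniform expansivity *)

Section orbit_close.
Context {R : realType} {X : metricType R}.
Implicit Types (f : X -> X) (n : nat) (c e : R) (x y z : X) (A : {fset X}).

(** As a set of [y], this is the closed ball of radius [e] around [x] for Bowen's metric of order
    [n]; it is all of [X] when [n] is 0. *)
Definition orbit_close f n e x y : Prop :=
  forall i, (i < n)%N -> mdist (iter i f x) (iter i f y) <= e.

Lemma orbit_close_sym f n e x y : orbit_close f n e x y -> orbit_close f n e y x.
Proof. by move=> xy i /xy; rewrite metric_sym. Qed.

Lemma orbit_close_trans f n e1 e2 y x z :
  orbit_close f n e1 x y -> orbit_close f n e2 y z ->
  orbit_close f n (e1 + e2) x z.
Proof.
move=> xy yz i ni; apply: le_trans (metric_triangle _ (iter i f y) _) _.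
by apply: lerD; [exact: xy | exact: yz].
Qed.

Lemma orbit_close_le f m n e x y : (m <= n)%N ->
  orbit_close f n e x y -> orbit_close f m e x y.
Proof. by move=> mn xy i im; apply: xy; exact: leq_trans mn. Qed.

Lemma orbit_close_iter f m n e x y :
  orbit_close f (n + m) e x y -> orbit_close f n e (iter m f x) (iter m f y).
Proof. by move=> xy i ni; rewrite -!iterD; apply: xy; rewrite ltn_add2r. Qed.

Lemma separatedP f n e A :
  separated f n e A <->
  {in A &, forall x y, orbit_close f n e x y -> x = y}.
Proof.
split=> [sA x y xA yA xy|sA x y xA yA xy].
  apply/eqP/negP => /negP /(sA _ _ xA yA)[i /xy].
  by rewrite leNgt => /negP.
apply: contrapT => nxy; move/eqP: xy; apply; apply: sA => // i ni.
by rewrite leNgt; apply/negP => ei; apply: nxy; exists i.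
Qed.

Lemma continuous_iter f i : continuous f -> continuous (iter i f).
Proof.
move=> cf; elim: i => [|i IHi] x; first exact: cvg_id.
by apply: (@continuous_comp _ _ _ (iter i f) f); [exact: IHi | exact: cf].
Qed.

Lemma near_orbit_close f n e x : continuous f -> 0 < e ->
  \forall y \near x, orbit_close f n e x y.
Proof.
move=> cf e0; elim: n => [|n IHn]; first exact: nearW.
have near_n : \forall y \near x, mdist (iter n f x) (iter n f y) <= e.
  exact: metricType_numDomainType.cvgr_dist_le (@continuous_iter f n cf x) e e0.
apply: filterS2 IHn near_n => y xy xyn i; rewrite ltnS leq_eqVlt => /orP[/eqP ->//|].
exact: xy.
Qed.

Lemma finite_orbit_net f n e : compact [set: X] -> continuous f -> 0 < e ->
  exists s : seq X, forall x, exists2 y, y \in s & orbit_close f n e y x.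
Proof.
move=> /compact_near_coveringP cX cf e0.
(* Finite lists directed by inclusion: enlarging a net keeps it a net, so compactness along this
   filter yields one list that serves all points. *)
pose up (s : seq X) := [set t : seq X | {subset s <= t}].
have upF : Filter (filter_from [set: seq X] up).
  apply: filter_from_filter => [|s t _ _]; first by exists [::].
  by exists (s ++ t) => // u stu; split=> z zs; apply: stu;
    rewrite mem_cat zs ?orbT.
have [|s _ us] := cX _ _ (fun s x => exists2 y, y \in s & orbit_close f n e y x) upF.
  move=> x _; exists (orbit_close f n e x, up [:: x]).
    by split; [exact: near_orbit_close | exists [:: x]].
  by move=> [y s] /= [xy xs]; exists x => //; apply: xs; rewrite inE.
by exists s => x; apply: us.
Qed.

(** Sending each point to a nearby member of an [e / 2]-net is injective on a separated set, so the
    size of the net is a bound. *)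
Lemma card_separated_le f n e : compact [set: X] -> continuous f -> 0 < e ->
  exists K, forall A, separated f n e A -> (#|` A| <= K)%N.
Proof.
move=> cX cf e0; have e20 : 0 < e / 2 by lra.
have [s net] := finite_orbit_net n cX cf e20.
have /choice[p pP] x : exists y, y \in s /\ orbit_close f n (e / 2) y x.
  by have [y ys yx] := net x; exists y.
exists (size s) => A /separatedP sA.
rewrite -(size_map p (enum_fset A)); apply: uniq_leq_size; last first.
  by move=> _ /mapP[x _ ->]; case: (pP x).
rewrite map_inj_in_uniq ?fset_uniq// => x y xA yA pxy; apply: sA => //.
rewrite [e]splitr; apply: (@orbit_close_trans _ _ _ _ (p x)).
  by apply: orbit_close_sym; case: (pP x).
by rewrite pxy; case: (pP y).
Qed.

(** A separated set of maximal cardinality works: a point far from all its members could be added to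
    it. *)
Lemma maximal_separated f n e : compact [set: X] -> continuous f -> 0 < e ->
  exists2 A, separated f n e A &
    forall x, exists2 y, y \in A & orbit_close f n e y x.
Proof.
move=> cX cf e0; have [K KP] := card_separated_le n cX cf e0.
pose P k := `[< exists2 A, separated f n e A & #|` A| = k >].
have P0 : exists k, P k.
  exists 0%N; apply/asboolP; exists fset0; last by rewrite cardfs0.
  by move=> x y; rewrite inE.
have PK k : P k -> (k <= K)%N by move=> /asboolP[A sA <-]; exact: KP.
case: (ex_maxnP P0 PK) => k /asboolP[A sA Ak] maxk; exists A => // x.
apply: contrapT => farx.
have xA : x \notin A.
  by apply/negP => xA; apply: farx; exists x => // i _; rewrite mdistxx ltW.
suff /maxk : P #|` x |` A|%fset by rewrite cardfsU1 xA Ak ltnn.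
apply/asboolP; exists (x |` A)%fset => //; apply/separatedP => y z.
rewrite !inE => /orP[/eqP ->|yA] /orP[/eqP ->|zA]// yz.
- by exfalso; apply: farx; exists z => //; apply: orbit_close_sym.
- by exfalso; apply: farx; exists y.
- by move/separatedP : sA; apply.
Qed.

Lemma uniform_iter_continuity f n e : compact [set: X] -> continuous f -> 0 < e ->
  exists2 d, 0 < d & forall x y, mdist x y <= d -> orbit_close f n e x y.
Proof.
move=> /compact_near_coveringP cX cf e0; have e20 : 0 < e / 2 by lra.
have : \forall d \near 0^'+,
    [set: X] `<=` [set x | forall y, mdist x y <= d -> orbit_close f n e x y].
  apply: cX => x _.
  have /metricType_numDomainType.nbhs_mdistP[r /= r0 xr] :=
    near_orbit_close n x cf e20.
  exists ([set y | mdist x y < r / 2], [set d | d < r / 2]).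
    split=> /=; last by apply: nbhs_right_lt; lra.
    by apply/metricType_numDomainType.nbhs_mdistP; exists (r / 2) => //=; lra.
  move=> [y d] /= [xy dr] z yz; rewrite [e]splitr.
  apply: (@orbit_close_trans _ _ _ _ x).
    by apply: orbit_close_sym; apply: xr => /=; lra.
  by apply: xr => /=; have := metric_triangle x y z; lra.
move=> near0; near (0 : R)^'+ => d; exists d => // x y.
have dP : [set: X] `<=` [set x | forall y, mdist x y <= d -> orbit_close f n e x y].
  by near: d.
exact: dP.
Unshelve. all: by end_near. Qed.

(** Compactness of the square of [X], along [N] tending to infinity: near a diagonal point the
    conclusion holds, and near any other point the premise fails for all large [N]. *)
Lemma uniform_expansivity f c e : compact [set: X] -> continuous f ->
  (forall x y, (forall n, mdist (iter n f x) (iter n f y) <= c) -> x = y) ->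
  0 < e -> exists N, forall x y, orbit_close f N c x y -> mdist x y <= e.
Proof.
move=> cX cf expf e0.
have /compact_near_coveringP cXX := compact_setX cX cX.
have : \forall N \near \oo, [set: X] `*` [set: X] `<=`
    [set p | orbit_close f N c p.1 p.2 -> mdist p.1 p.2 <= e].
  apply: cXX => -[x y] _.
  have [<-|xNy] := pselect (x = y).
    exists ([set p | mdist x p.1 <= e / 2 /\ mdist x p.2 <= e / 2], setT).
      split; last exact: filterT.
      have xe : \forall z \near x, mdist x z <= e / 2.
        have e20 : 0 < e / 2 by lra.
        by apply: filterS (near_orbit_close 1 x cf e20) => z /(_ 0%N (ltn0Sn 0)).
      by exists ([set z | mdist x z <= e / 2], [set z | mdist x z <= e / 2]).
    move=> [[z t] N] /= [[xz xt] _] _.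
    by have := metric_triangle z x t; rewrite (metric_sym z x); lra.
  have [n] : exists n, c < mdist (iter n f x) (iter n f y).
    apply: contrapT => close; apply: xNy; apply: expf => n; rewrite leNgt.
    by apply/negP => cn; apply: close; exists n.
  (* Two errors of [(D - c) / 3] still leave a distance greater than [c] at time [n]. *)
  set D := mdist _ _ => cD; have g0 : 0 < (D - c) / 3 by lra.
  exists ([set p | orbit_close f n.+1 ((D - c) / 3) x p.1 /\
                   orbit_close f n.+1 ((D - c) / 3) y p.2], [set N | (n < N)%N]).
    split; last exact: nbhs_infty_gt.
    by exists (orbit_close f n.+1 ((D - c) / 3) x,
      orbit_close f n.+1 ((D - c) / 3) y); first split;
      [exact: near_orbit_close | exact: near_orbit_close | ].
  move=> [[z t] N] /= [[xz yt] nN] /(_ n nN) zt.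
  have := xz _ (ltnSn n); have := yt _ (ltnSn n).
  have := metric_triangle (iter n f x) (iter n f z) (iter n f y).
  have := metric_triangle (iter n f z) (iter n f t) (iter n f y).
  by rewrite (metric_sym (iter n f t) (iter n f y)) -/D; lra.
by move=> [N _ /(_ N (leqnn N)) NP]; exists N => x y; apply: (NP (x, y)).
Qed.

End orbit_close.

(** * Finite covering dimension *)

Lemma positively_expansive_covering_dimension (R : realType) (X : metricType R)
    (f : X -> X) : compact [set: X] -> continuous f -> positively_expansive f ->
  exists m, @covering_dimension_le R X m.
Proof.
move=> cX cf [c c0 expf].
have c4 : 0 < c / 4 by lra.
have [N NP] := uniform_expansivity cX cf expf c4.
have [K KP] := card_separated_le N cX cf c4.
(* [K] is fixed before [e]; only [n] below depends on [e]. *)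
exists K => e e0.
have [n nP] := uniform_expansivity cX cf expf e0.
have [A sA netA] := maximal_separated (N + n) cX cf c4.
(* The net has radius [c / 4], so the interiors of the balls of radius [c / 2] still cover [X],
   while two points of one ball remain [c]-close. *)
pose V y := interior (orbit_close f (N + n) (c / 2) y).
have VP y x : V y x -> orbit_close f (N + n) (c / 2) y x by exact: interior_subset.
exists (V @` [set` A]); split.
- apply/seteqP; split=> // x _; have [y yA yx] := netA x.
  exists (V y); first by exists y.
  apply: filterS (near_orbit_close (N + n) x cf c4) => z xz.
  by rewrite (_ : c / 2 = c / 4 + c / 4); [exact: orbit_close_trans xz | lra].
- by move=> _ [y _ <-]; exact: open_interior.
- move=> _ [y _ <-]; apply: ge_ereal_sup => _ [[z t] /= [/VP yz /VP yt] <-].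
  rewrite lee_fin; apply: nP; apply: (orbit_close_le (leq_addl N n)).
  by rewrite [c]splitr; apply: orbit_close_trans yt; exact: orbit_close_sym.
- move=> x; pose B := [fset y in A | `[< V y x >]]%fset.
  have BP y : y \in B -> y \in A /\ V y x.
    by rewrite !inE /= => /andP[yA /asboolP].
  have BN y z : y \in B -> z \in B ->
      orbit_close f N (c / 4) (iter n f y) (iter n f z) -> y = z.
    move=> /BP[yA /VP yx] /BP[zA /VP zx] yzN.
    move/separatedP : sA; apply => // i.
    have yz : orbit_close f (N + n) c y z.
      by rewrite [c]splitr; apply: orbit_close_trans yx _; exact: orbit_close_sym.
    (* From time [n] on, [yzN] applies; before it, at least [N] steps of [c]-closeness follow time
       [i], so [NP] applies. *)
    have [ni|ni] := leqP n i => iNn.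
      by have := yzN (i - n)%N; rewrite -!iterD subnK//; apply; lia.
    apply: NP; apply: orbit_close_iter; apply: orbit_close_le yz; lia.
  have cardB : (#|` B| <= K)%N.
    have <- : #|` [fset iter n f y | y in B]%fset| = #|` B|.
      by apply: card_in_imfset => y z yB zB yz; apply: BN => // i _;
        rewrite yz mdistxx ltW.
    apply: KP; apply/separatedP => _ _ /imfsetP[y /= yB ->] /imfsetP[z /= zB ->].
    by move=> /(BN _ _ yB zB) ->.
  apply: (@card_le_trans _ _ _ (V @` [set` B])).
    apply: subset_card_le => W [[y yA <-] Vyx]; exists y => //=.
    by rewrite !inE /= yA; apply/asboolP.
  apply: card_le_trans (card_image_le _ _) _.
  have /card_eqPle[+ _] : ([set` B] #= `I_#|` B|)%card by apply/card_eq_fsetP.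
  move=> /card_le_trans; apply; apply: subset_card_le => i /= iB.
  by apply: leqW; exact: leq_trans iB cardB.
Qed.

(** * Chains in connected sets and their branching *)

Section chains.
Context {R : realType} {X : metricType R}.
Implicit Types (f : X -> X) (g : nat -> X) (d r : R) (x y z : X) (C : set X).

Definition chain d g (a b : nat) : Prop :=
  forall j, (a <= j < b)%N -> mdist (g j) (g j.+1) <= d.

Lemma sub_chain d g a b a' b' : (a <= a')%N -> (b' <= b)%N ->
  chain d g a b -> chain d g a' b'.
Proof. by move=> aa' bb' ch j j_ab; apply: ch; lia. Qed.

(** Stop at the first index at distance at least [r] from the start: the last step overshoots by at
    most [d]. *)
Lemma chain_prefix d r g a b : 0 <= d -> 0 < r -> (a <= b)%N -> chain d g a b ->
  r <= mdist (g a) (g b) ->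
  exists m, [/\ (a <= m <= b)%N, r <= mdist (g a) (g m)
    & forall j, (a <= j <= m)%N -> mdist (g a) (g j) <= r + d].
Proof.
move=> d0 r0 ab ch rab.
pose P m := (a <= m <= b)%N && (r <= mdist (g a) (g m)).
have exP : exists m, P m by exists b; rewrite /P ab leqnn.
case: (ex_minnP exP) => m /andP[amb rm] minm; exists m; split=> // j /andP[aj].
have lt_r i : (a <= i < m)%N -> mdist (g a) (g i) < r.
  move=> aim; rewrite ltNge; apply/negP => ri.
  have /minm : P i by rewrite /P ri andbT; lia.
  by lia.
rewrite leq_eqVlt => /orP[/eqP ->|jm]; last first.
  by have := lt_r j; rewrite aj jm => /(_ isT); lra.
case: m amb rm minm lt_r => [|m] amb rm _ lt_r.
  have -> : a = 0%N by lia.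
  by rewrite mdistxx; lra.
have [am|ma] := leqP a m; last first.
  have -> : a = m.+1 by lia.
  by rewrite mdistxx; lra.
have := lt_r m; rewrite am ltnSn => /(_ isT).
have := metric_triangle (g a) (g m) (g m.+1).
have : mdist (g m) (g m.+1) <= d by apply: ch; lia.
lra.
Qed.

Lemma chain_rev d g a b : chain d g a b -> chain d (fun j => g (a + b - j)%N) a b.
Proof.
move=> ch j jab; rewrite metric_sym.
rewrite (_ : (a + b - j)%N = (a + b - j.+1).+1); last by lia.
by apply: ch; lia.
Qed.

Lemma chain_suffix d r g a b : 0 <= d -> 0 < r -> (a <= b)%N -> chain d g a b ->
  r <= mdist (g a) (g b) ->
  exists m, [/\ (a <= m <= b)%N, r <= mdist (g m) (g b)
    & forall j, (m <= j <= b)%N -> mdist (g j) (g b) <= r + d].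
Proof.
move=> d0 r0 ab /chain_rev ch rab.
have [|m [amb rm mP]] := chain_prefix d0 r0 ab ch.
  by rewrite addnK addKn metric_sym.
exists (a + b - m)%N; rewrite addKn in rm mP.
split; [by lia | by rewrite metric_sym | move=> j jmb].
have := mP (a + b - j)%N.
rewrite (_ : (a + b - (a + b - j))%N = j); last by lia.
by rewrite metric_sym; apply; lia.
Qed.

(** The points reachable from [x] by steps of length at most [d] form a clopen set. *)
Lemma connected_chain C d x y : 0 < d -> connected C -> C x -> C y ->
  exists g b, [/\ g 0%N = x, g b = y & chain d g 0 b].
Proof.
move=> d0 conC Cx Cy; pose near_pt : rel X := [rel z t | mdist z t <= d].
pose reach z := exists2 p, path near_pt x p & last x p = z.
have reachS z t : mdist z t <= d -> reach z -> reach t.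
  move=> zt [p xp pz]; exists (rcons p t); last by rewrite last_rcons.
  by rewrite rcons_path xp pz.
have near_d z : \forall t \near z, mdist z t <= d.
  by apply/metricType_numDomainType.nbhs_mdistP; exists d => //= t /ltW.
suff : reach y.
  move=> [p /(pathP x) xp py].
  by exists (nth x (x :: p)), (size p); split=> //; rewrite -last_nth.
suff : (C `&` reach) y by case.
rewrite (conC (C `&` reach))//.
- by exists x; split=> //; exists [::].
- exists reach => //; rewrite openE => z rz.
  by apply: filterS (near_d z) => t zt; exact: reachS rz.
- exists reach => //; rewrite -[reach]setCK; apply: open_closedC.
  rewrite openE => z rz; apply: filterS (near_d z) => t zt rt; apply: rz.
  by apply: reachS rt; rewrite metric_sym.
Qed.

(** Selecting indices rather than points lets the induction on [k] pass from the chain [g] to its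
    image under an iterate of [f] and back. *)
Lemma chain_branching f c N k : compact [set: X] -> continuous f -> 0 < c ->
  (forall x y, orbit_close f N c x y -> mdist x y < c / 4) ->
  exists2 d, 0 < d & forall g a b, (a <= b)%N -> chain d g a b ->
    c / 4 <= mdist (g a) (g b) ->
    exists s : seq nat, [/\ uniq s, size s = (2 ^ k)%N,
      forall j, j \in s -> (a <= j <= b)%N
      & {in s &, forall j l, orbit_close f (k * N) (c / 8) (g j) (g l) -> j = l}].
Proof.
move=> cX cf c0 NP; have c40 : 0 < c / 4 by lra.
elim: k => [|k [d0 d00 IHk]].
  exists 1 => // g a b ab _ _; exists [:: a]; split=> //.
    by move=> j; rewrite inE => /eqP ->; rewrite leqnn.
  by move=> j l; rewrite !inE => /eqP -> /eqP ->.
(* [d0] serves the induction hypothesis; [c / 8] keeps each end piece within [3 * c / 8] of its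
   endpoint, so that the two pieces are more than [c / 4] apart. *)
pose d1 := Num.min d0 (c / 8).
have d10 : 0 < d1 by rewrite lt_min d00; lra.
have d1d0 : d1 <= d0 by rewrite ge_min lexx.
have d1c : d1 <= c / 8 by rewrite ge_min lexx orbT.
have [d2 d20 d2P] := uniform_iter_continuity N cX cf d10.
exists d2 => // g a b ab ch gab.
have [i iN ci] : exists2 i, (i < N)%N & c < mdist (iter i f (g a)) (iter i f (g b)).
  apply: contrapT => close.
  suff /NP : orbit_close f N c (g a) (g b) by rewrite ltNge gab.
  by move=> i iN; rewrite leNgt; apply/negP => ci; apply: close; exists i.
pose h j := iter i f (g j).
have ch1 : chain d1 h a b by move=> j jab; apply: d2P iN; exact: ch.
have ch0 : chain d0 h a b by move=> j /ch1/le_trans; apply.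
have hab : c / 4 <= mdist (h a) (h b) by rewrite /h; lra.
have [m [/andP[am mb] hm mP]] := chain_prefix (ltW d10) c40 ab ch1 hab.
have [l [/andP[al lb] hl lP]] := chain_suffix (ltW d10) c40 ab ch1 hab.
have [s [s_uniq s_size s_ab sP]] := IHk h a m am (sub_chain (leqnn a) mb ch0) hm.
have [t [t_uniq t_size t_ab tP]] := IHk h l b lb (sub_chain al (leqnn b) ch0) hl.
(* Since [i < N], at least [k * N] of the [k.+1 * N] steps remain after time [i]. *)
have close_h j j' : orbit_close f (k.+1 * N) (c / 8) (g j) (g j') ->
    orbit_close f (k * N) (c / 8) (h j) (h j').
  move=> jj'; apply: orbit_close_iter; apply: orbit_close_le jj'.
  by rewrite mulSn addnC leq_add2r ltnW.
have far j j' : j \in s -> j' \in t -> c / 8 < mdist (h j) (h j').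
  move=> /s_ab/mP aj /t_ab/lP jb.
  have := metric_triangle (h a) (h j) (h b).
  have := metric_triangle (h j) (h j') (h b).
  by move: ci; rewrite -/(h a) -/(h b); lra.
have not_close j j' : j \in s -> j' \in t ->
    ~ orbit_close f (k.+1 * N) (c / 8) (g j) (g j').
  move=> js j't /(_ i) jj'; have := far _ _ js j't.
  by rewrite ltNge jj'// mulSn ltn_addr.
exists (s ++ t); split.
- rewrite cat_uniq s_uniq t_uniq andbT /=; apply/hasPn => j jt; apply/negP => js.
  by apply: (not_close j j js jt) => ? _; rewrite mdistxx; lra.
- by rewrite size_cat s_size t_size addnn -mul2n expnS.
- move=> j; rewrite mem_cat => /orP[/s_ab|/t_ab] /andP[j1 j2].
    by rewrite j1 (leq_trans j2 mb).
  by rewrite (leq_trans al j1) j2.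
move=> j j'; rewrite !mem_cat => /orP[js|jt] /orP[j's|j't] jj'.
- by apply: sP => //; exact: close_h.
- by case: (not_close j j').
- by case: (not_close j' j) => //; exact: orbit_close_sym.
- by apply: tP => //; exact: close_h.
Qed.

End chains.

(** * Lower bounds for the entropy *)

Lemma separated_growth_ge (R : realType) (X : metricType R) (f : X -> X)
    (N : nat) (e : R) : (0 < N)%N ->
  (forall k, exists2 A : {fset X}, separated f (k * N) e A & #|` A| = (2 ^ k)%N) ->
  ((ln 2 / N%:R)%:E <= separated_growth f e)%E.
Proof.
move=> N0 sepP; rewrite /separated_growth limn_esup_lim.
apply: lime_ge; first exact: is_cvg_esups.
(* Every tail contains a multiple of [N], where the term is at least [ln 2 / N]; the successor keeps
   [m] positive. *)
apply: nearW => n; set m := (n.+1 * N)%N.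
have m0 : (0 < m)%N by rewrite muln_gt0.
apply: (@le_trans _ _ ((m%:R^-1)%:E * lne (max_separated f m e))%E); last first.
  apply: ereal_sup_ubound; exists m => //=.
  by rewrite /m (leq_trans (leqnSn n))// leq_pmulr.
have [A sA cardA] := sepP n.+1.
have max2 : ((2 ^+ n.+1)%:E <= max_separated f m e)%E.
  by apply: ereal_sup_ubound => /=; exists A => //; rewrite cardA natrX.
have -> : ln 2 / N%:R = m%:R^-1 * ln (2 ^+ n.+1) :> R.
  rewrite lnXn// -[ln 2 *+ _]mulr_natl /m natrM invfM mulrACA mulVf ?pnatr_eq0//.
  by rewrite mul1r mulrC.
rewrite EFinM -lne_EFin ?exprn_gt0//.
apply: lee_wpmul2l; first by rewrite lee_fin invr_ge0.
have pow0 : (0 <= (2 ^+ n.+1 : R)%:E)%E by rewrite lee_fin exprn_ge0.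
by rewrite lee_lne ?in_itv/= ?leey ?andbT// (le_trans pow0).
Qed.

Lemma topological_entropy_ge (R : realType) (X : metricType R) (f : X -> X)
    (e : R) : 0 < e -> (separated_growth f e <= topological_entropy f)%E.
Proof.
move=> e0; rewrite /topological_entropy.
rewrite (cvg_lim _ (@separated_growth_cvg R X f))//; apply: ereal_sup_ubound.
by exists e.
Qed.

Lemma positively_expansive_entropy_gt0 (R : realType) (X : metricType R)
    (f : X -> X) (C : set X) (x y : X) : compact [set: X] -> continuous f ->
  positively_expansive f -> connected C -> C x -> C y -> x <> y ->
  (0 < topological_entropy f)%E.
Proof.
move=> cX cf [c c0 expf] conC Cx Cy xNy.
have [c50 c80] : 0 < c / 5 /\ 0 < c / 8 by lra.
have [N0 N0P] := uniform_expansivity cX cf expf c50.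
have [N [N_gt0 NP]] : exists N, (0 < N)%N /\
    forall x y, orbit_close f N c x y -> mdist x y < c / 4.
  (* The bound [c / 5] gives the strict inequality, and the successor makes [N] positive. *)
  exists N0.+1; split=> // z t /(orbit_close_le (leqnSn N0))/N0P; lra.
have [n cn] : exists n, c < mdist (iter n f x) (iter n f y).
  apply: contrapT => close; apply: xNy; apply: expf => n; rewrite leNgt.
  by apply/negP => cn; apply: close; exists n.
apply: lt_le_trans (topological_entropy_ge f c80).
apply: lt_le_trans (separated_growth_ge N_gt0 _).
  by rewrite lte_fin divr_gt0 ?ln_gt0 ?ltr0n// ltr1n.
move=> k; have [d d0 dP] := chain_branching k cX cf c0 NP.
(* Order [n.+1] includes time [n], so the [n]-th iterate of [f] turns a [d']-chain from [x] to [y]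
   into a [d]-chain whose endpoints are more than [c] apart. *)
have [d' d'0 d'P] := uniform_iter_continuity n.+1 cX cf d0.
have [g [b [g0 gb ch]]] := connected_chain d'0 conC Cx Cy.
have [|||s [s_uniq s_size _ sP]] := dP (fun j => iter n f (g j)) 0%N b.
- by [].
- by move=> j /ch/d'P; apply.
- by rewrite g0 gb; lra.
exists [fset iter n f (g j) | j in s]%fset.
  apply/separatedP => _ _ /imfsetP[j /= js ->] /imfsetP[l /= ls ->].
  by move=> /(sP _ _ js ls) ->.
rewrite -s_size card_in_imfset /=.
  by rewrite undup_id.
move=> j l js ls jl; apply: sP => // i _; rewrite jl mdistxx; lra.
Qed.

Theorem corollary6 (R : realType) (X : metricType R) (cX : compact [set: X]) :
  ((exists f : X -> X, continuous f /\ positively_expansive f) ->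
     (topological_dimension X < +oo)%E) /\
  ((exists f : X -> X, [/\ continuous f, positively_expansive f
                         & topological_entropy f = 0%E]) ->
     totally_disconnected [set: X]).
Proof.
split=> [[f [cf expf]]|[f [cf expf hf]] x _].
  have [m dim_m] := positively_expansive_covering_dimension cX cf expf.
  apply: le_lt_trans (ltry m%:R); apply: ereal_inf_lbound.
  by exists m.
apply/seteqP; split=> [y [C [Cx _ conC] Cy]|_ ->]; last first.
  exact: connected_component_refl.
apply: contrapT => yNx; suff : (0 < topological_entropy f)%E by rewrite hf ltxx.
by apply: (positively_expansive_entropy_gt0 cX cf expf conC Cx Cy) => /esym.
Qed.
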